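(* Let $(\chi_n)_{n\ge 1}$, $f$, $a$, $H$, $f^H$ and $F$ be as in the context. Let $l>0$ satisfy $$l<\min\{H-f^H,\;F(a)\},$$ let $x_0\in(0,H)$ be arbitrary and let $(x_n)$ be the solution of $x_{n+1}=\max\{f(x_n)+l\chi_{n+1},0\}$, $n=0,1,2,\dots$, with initial value $x_0$. Then, almost surely, for all $n\in\mathbb N$: (i) $x_n\le H$; (ii) if in addition $x_0\in(a,H)$, then $x_n\in(a,H)$.
   Context: $(\chi_n)_{n\ge1}$ is a sequence of independent identically distributed continuous real random variables with zero mean on a complete probability space, whose common density $\phi$ satisfies $\phi(x)>0$ for $x\in(-1,1)$ and $\phi(x)=0$ for $x\notin[-1,1]$. $f:[0,\infty)\to[0,\infty)$ is continuous, $f(0)=0$, $f(x)>0$ for $x>0$, and there are fixed positive numbers $a<H$ such that (1) $f^H:=\max_{x\in[0,H]}f(x)<H$; (2) $f(x)>f(a)>a$ for all $x\in(a,H]$. $F(x):=f(x)-x$ for $x\in[0,\infty)$. The initial value $x_0$ is deterministic. *)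

(* Defs.v *)
From HB Require Import structures.
From mathcomp Require Import all_boot all_order all_algebra finmap.
From mathcomp Require Import all_classical all_reals all_analysis.
Import Order.TTheory GRing.Theory Num.Theory.
Import numFieldNormedType.Exports.

Set Implicit Arguments.
Unset Strict Implicit.
Unset Printing Implicit Defensive.

Local Open Scope classical_set_scope.
Local Open Scope ring_scope.

Definition mutually_independent d (T : measurableType d) (R : realType)
    (P : probability T R) (X : nat -> {RV P >-> R}) : Prop :=
  forall (J : {fset nat}) (B : nat -> set R),
    (forall j, j \in J -> measurable (B j)) ->
    P (\bigcap_(j in [set` J]) (X j @^-1` B j)) =
      (\prod_(j <- J) P (X j @^-1` B j))%E.

Definition has_density d (T : measurableType d) (R : realType)
    (P : probability T R) (X : {RV P >-> R}) (phi : R -> R) : Prop :=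
  [/\ measurable_fun [set: R] phi,
      forall u, 0 <= phi u &
      forall B : set R, measurable B ->
        distribution P X B = (\int[lebesgue_measure]_(u in B) (phi u)%:E)%E].

Definition is_maximum (R : realType) (A : set R) (m : R) : Prop :=
  A m /\ ubound A m.

Definition drift (R : realType) (f : R -> R) (u : R) : R := f u - u.

(* Main.v *)
Require Import Defs.
From mathcomp Require Import all_boot all_order all_algebra.
From mathcomp Require Import all_classical all_reals all_analysis.
From mathcomp Require Import lra.
Import Order.TTheory GRing.Theory Num.Theory.
Import numFieldNormedType.Exports.
Local Open Scope classical_set_scope.
Local Open Scope ring_scope.

(** Almost surely every noise value lies in [[-1, 1]], since [phi] vanishes outside it and there are
    countably many values. On that event the claim is deterministic: the noise shifts [f (x n w)] by
    at most [l]. Upwards, [f <= fH] on [[0, H]] and [l < H - fH] keep the next value below [H].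
    Downwards, from a point of [(a, H]] one has [f (x n w) - l > f a - l > a]. Induction on [n]
    concludes. *)

(** The event that [X] leaves [D] has as probability the integral of [phi] over the complement of
    [D], where [phi] is zero. *)
Lemma density_support_ae (R : realType) (d : measure_display)
  (T : measurableType d) (P : probability T R) (X : {RV P >-> R})
  (phi : R -> R) (D : set R) :
  has_density X phi -> measurable D -> (forall u, ~ D u -> phi u = 0) ->
  {ae P, forall w, D (X w)}.
Proof.
move=> [_ _ densX] mD phi0.
have mDC : measurable (~` D) by exact: measurableC.
exists (X @^-1` (~` D)); split => //.
- by rewrite -[X @^-1` _]setTI; exact: measurable_funPT.
- have -> : P (X @^-1` (~` D)) = distribution P X (~` D) by [].
  by rewrite densX// integral0_eq// => u /phi0 ->.
Qed.

(** The largest upward push is [l], smaller than the gap [H - fH]; truncation at 0 is harmless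
    because [0 < H]. *)
Lemma perturbed_lt (R : realType) (f : R -> R) (H fH l u c : R) :
  is_maximum (f @` `[0, H]) fH -> 0 < H -> 0 <= l -> l < H - fH ->
  0 <= u <= H -> c <= 1 -> Num.max (f u + l * c) 0 < H.
Proof.
move=> [_ fH_ub] H_gt0 l_ge0 l_lt u_in c_le1; rewrite gt_max H_gt0 andbT.
have fu_le : f u <= fH by apply: fH_ub; exists u => //=; rewrite in_itv.
have lc_le : l * c <= l by rewrite ler_piMr.
lra.
Qed.

(** The worst push is [- l], smaller in size than the drift at [a]; truncation can only raise the
    value. *)
Lemma perturbed_gt (R : realType) (f : R -> R) (a l u c : R) :
  0 <= l -> l < drift f a -> f a < f u -> -1 <= c ->
  a < Num.max (f u + l * c) 0.
Proof.
rewrite /drift => l_ge0 l_lt fa_lt c_ge; rewrite lt_max.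
have lc_ge : - l <= l * c by rewrite -mulrN1 ler_wpM2l.
by apply/orP; left; lra.
Qed.

Theorem lemma3p2 (R : realType) (d : measure_display) (T : measurableType d)
  (P : probability T R) (P_complete : measure_is_complete P)
  (* the noise is the family (chi n), n >= 1; chi 0 plays no role *)
  (chi : nat -> {RV P >-> R}) (phi : R -> R)
  (chi_indep : mutually_independent (fun n => chi n.+1))
  (chi_density : forall n, (1 <= n)%N -> has_density (chi n) phi)
  (chi_mean : forall n, (1 <= n)%N -> ('E_P[chi n] = 0)%E)
  (phi_pos : forall u, -1 < u < 1 -> 0 < phi u)
  (phi_out : forall u, ~ (-1 <= u <= 1) -> phi u = 0)
  (f : R -> R)
  (f_cont : {within `[0, +oo[, continuous f})
  (f_ge0 : forall u, 0 <= u -> 0 <= f u)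
  (f_0 : f 0 = 0)
  (f_pos : forall u, 0 < u -> 0 < f u)
  (a H fH : R) (a_gt0 : 0 < a) (a_lt_H : a < H)
  (fH_max : is_maximum (f @` `[0, H]) fH)
  (fH_lt_H : fH < H)
  (f_above : forall u, a < u <= H -> a < f a < f u)
  (l : R) (l_gt0 : 0 < l)
  (l_small : l < Num.min (H - fH) (drift f a))
  (x0 : R) (x0_in : 0 < x0 < H)
  (x : nat -> T -> R)
  (x_init : forall w, x 0%N w = x0)
  (x_step : forall n w,
     x n.+1 w = Num.max (f (x n w) + l * chi n.+1 w) 0) :
  {ae P, forall w, forall n,
     x n w <= H /\ (a < x0 < H -> a < x n w < H)}.
Proof.
have H_gt0 : 0 < H by lra.
move: l_small; rewrite lt_min => /andP[l_lt_H l_lt_drift].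
have chi_bound : {ae P, forall w, forall n, -1 <= chi n.+1 w <= 1}.
  (* A countable union of null sets is null, so a single exceptional set serves all times. *)
  apply/ae_foralln => n.
  have [] := @density_support_ae R d T P (chi n.+1) phi `[-1, 1]%classic
    (chi_density n.+1 isT) (measurable_itv _).
    by move=> u /= u_out; apply: phi_out => u_in; apply: u_out; rewrite in_itv.
  by move=> N [mN N0 subN]; exists N; split => // w w_out; apply: subN => /= w_in;
    apply: w_out => /=; rewrite in_itv/= in w_in.
apply: filterS chi_bound => w chi_w.
(* Nonnegativity joins the induction hypothesis because [fH] bounds [f] only on [[0, H]]; the
   truncation preserves it. *)
suff main n : 0 <= x n w <= H /\ (a < x0 < H -> a < x n w < H).
  by move=> n; have [/andP[_ ->] ?] := main n.
elim: n => [|n [x_in IH]]; first by rewrite x_init; split => //; lra.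
have /andP[chi_ge chi_le] := chi_w n.
(* This strict bound needs no lower bound by [a], so it serves both claims. *)
have x_lt := perturbed_lt _ _ _ _ _ _ _ fH_max H_gt0 (ltW l_gt0) l_lt_H x_in chi_le.
rewrite x_step; split; first by rewrite le_max lexx orbT ltW.
move=> /IH /andP[x_gta x_ltH]; rewrite x_lt andbT.
apply: perturbed_gt => //; first exact: ltW.
by have /f_above/andP[] : a < x n w <= H by rewrite x_gta ltW.
Qed.
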